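(* Consider the aggregative optimization problem $$\min_{\boldsymbol{x}\in X=\prod_{i=1}^N X_i} f(\boldsymbol{x})=\sum_{i=1}^N f_i(x_i,\delta(\boldsymbol{x})),\qquad \delta(\boldsymbol{x})=\frac1N\sum_{i=1}^N\phi_i(x_i),$$ and let $\boldsymbol{x}^\star\in X$ be an optimal solution. Suppose that the assumptions on the constraint sets and the global objective (A1), on the local functions (A2), and on the communication graphs (A3) listed in the context hold. Let $\boldsymbol{x}_k=\operatorname{col}(x_{1,k},\dots,x_{N,k})$, $k\ge 0$, be the iterates generated by the distributed projection-free algorithm described in the context, where the step sizes $\gamma_k\in[0,1)$ satisfy: (i) $0\le\gamma_{k+1}\le\gamma_k\le 1$ for all $k\ge 0$; (ii) $\sum_{k=0}^\infty\gamma_k=\infty$; (iii) $\sum_{k=0}^\infty\gamma_k^2<\infty$. Then $$\lim_{k\to\infty} f(\boldsymbol{x}_k)=f(\boldsymbol{x}^\star).$$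
   Context: **Problem data.** $\mathcal N=\{1,\dots,N\}$ is the set of agents. Agent $i$ has a decision variable $x_i\in\mathbb R^{n_i}$, a nonempty constraint set $X_i\subset\mathbb R^{n_i}$, a function $\phi_i:\mathbb R^{n_i}\to\mathbb R^d$, and a differentiable local cost $f_i(x_i,\delta(\boldsymbol x))$. Write $X=\prod_{i=1}^N X_i$, and $\boldsymbol x=\operatorname{col}(x_1,\dots,x_N)$ for the stacked column vector. Write $f_i(x_i,\delta(\boldsymbol x))=g_i(x_i,z_i)|_{z_i=\delta(\boldsymbol x)}$ with $g_i:\mathbb R^{n_i+d}\to\mathbb R$ differentiable. For $\boldsymbol z=\operatorname{col}(z_1,\dots,z_N)\in\mathbb R^{Nd}$ let $g(\boldsymbol x,\boldsymbol z)=\sum_{i=1}^N g_i(x_i,z_i)$, $\nabla_1 g(\boldsymbol x,\boldsymbol z)=\operatorname{col}(\nabla_{x_i}g_i(x_i,z_i))_{i\in\mathcal N}$ and $\nabla_2 g(\boldsymbol x,\boldsymbol z)=\operatorname{col}(\nabla_{z_i}g_i(x_i,z_i))_{i\in\mathcal N}$. The gradient $\nabla\phi_i(x_i)\in\mathbb R^{n_i\times d}$ is the transpose of the Jacobian of $\phi_i$. $\|\cdot\|$ is the Euclidean norm (and the induced norm for matrices). **(A1)** (a) Each $X_i$ is closed, convex and compact. (b) $f$ is convex and differentiable in $\boldsymbol x\in X$, and its gradient is $L$-Lipschitz on $X$: for all $\mathbf x,\mathbf y\in X$, $f(\mathbf y)-f(\mathbf x)\ge(\mathbf y-\mathbf x)^\top\nabla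 f(\mathbf x)$ and $\|\nabla f(\mathbf x)-\nabla f(\mathbf y)\|\le L\|\mathbf x-\mathbf y\|$. **(A2)** There are constants $l_1,l_2,l_3$ and $c_i>0$ such that: (a) for every $\boldsymbol x\in X$ and all $\boldsymbol z_1,\boldsymbol z_2\in\mathbb R^{Nd}$, $\|\nabla_1 g(\boldsymbol x,\boldsymbol z_1)-\nabla_1 g(\boldsymbol x,\boldsymbol z_2)\|\le l_1\|\boldsymbol z_1-\boldsymbol z_2\|$; (b) for all $\boldsymbol x_1,\boldsymbol x_2\in X$ and $\boldsymbol z_1,\boldsymbol z_2\in\mathbb R^{Nd}$, $\|\nabla_2 g(\boldsymbol x_1,\boldsymbol z_1)-\nabla_2 g(\boldsymbol x_2,\boldsymbol z_2)\|\le l_2\|\boldsymbol x_1-\boldsymbol x_2\|+l_2\|\boldsymbol z_1-\boldsymbol z_2\|$; (c) for each $i$, $\phi_i$ is differentiable in $x_i\in X_i$ and $\|\nabla\phi_i(x_i)\|\le c_i$ for all $x_i\in X_i$; (d) for each $i$, $\phi_i$ is $l_3$-Lipschitz continuous on $X_i$. **(A3)** At each time $k\ge 0$ the agents communicate over a directed graph $\mathcal G_k=\{\mathcal N,\mathcal E_k\}$, where $(j,i)\in\mathcal E_k$ means that $i$ can obtain information from $j$. The adjacency matrix $W_k=[\omega_{ij,k}]_{i,j=1}^N$ satisfies $\omega_{ij,k}>0$ if and only if $(j,i)\in\mathcal E_k$, and $\omega_{ij,k}=0$ otherwise. $\mathcal N_{i,k}=\{j\in\mathcal N:(j,i)\in\mathcal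 E_k\}$ is the neighbor set of $i$ at time $k$. Moreover: (a) $W_k$ is doubly stochastic (nonnegative, with all row sums and column sums equal to $1$) for every $k\ge 0$; (b) there is a constant $0<\eta<1$ with $\omega_{ij,k}\ge\eta$ for all $j\in\mathcal N_{i,k}$, $i\in\mathcal N$, $k\ge 0$; (c) there is a positive integer $B$ such that the union graph $\{\mathcal N,\bigcup_{l=1}^B\mathcal E_{k+l}\}$ is strongly connected (there is a directed path from any node to any other node) for all $k\ge 0$. **Algorithm.** Initialize $x_{i,0}\in X_i$, $v_{i,0}=\phi_i(x_{i,0})$, $y_{i,0}=\nabla_{z_i}g_i(x_{i,0},v_{i,0})$ for each $i\in\mathcal N$. For $k=0,1,2,\dots$ and each $i\in\mathcal N$: $$\hat v_{i,k+1}=\sum_{j\in\mathcal N_{i,k}}\omega_{ij,k}v_{j,k},\qquad \hat y_{i,k+1}=\sum_{j\in\mathcal N_{i,k}}\omega_{ij,k}y_{j,k},$$ $$s_{i,k}\in\operatorname*{argmin}_{s_i\in X_i}\big\langle\nabla_{x_i}g_i(x_{i,k},\hat v_{i,k+1})+\nabla\phi_i(x_{i,k})\hat y_{i,k+1},\,s_i\big\rangle\quad\text{(any minimizer)},$$ $$x_{i,k+1}=(1-\gamma_k)x_{i,k}+\gamma_k s_{i,k},$$ $$v_{i,k+1}=\hat v_{i,k+1}+\phi_i(x_{i,k+1})-\phi_i(x_{i,k}),$$ $$y_{i,k+1}=\hat y_{i,k+1}+\nabla_{z_i}g_i(x_{i,k+1},v_{i,k+1})-\nabla_{z_i}g_i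(x_{i,k},v_{i,k}).$$
   Formalization: The formal theorem adds that every agent is its own neighbor at all times, (i,i) in E_k, so ω_{ii,k} ≥ η; without self-loops the claim fails (two agents swapping values forever: W_k = swap, φ_1=10, φ_2=-8, g_1=xz, g_2=0). *)

(* Defs.v *)
From HB Require Import structures.
From mathcomp Require Import all_boot all_order all_algebra.
From mathcomp Require Import all_classical all_reals all_analysis.

Set Implicit Arguments.
Unset Strict Implicit.
Unset Printing Implicit Defensive.

Import Order.TTheory GRing.Theory Num.Theory.
Import numFieldNormedType.Exports.

Local Open Scope classical_set_scope.
Local Open Scope ring_scope.

Section Euclidean.
Variable R : realType.

Definition dotv m (u v : 'cV[R]_m) : R := (u^T *m v) 0 0.

(* The library norm on matrices is the sup norm; it induces the same topology
   and the same notion of differentiability as the Euclidean norm, but the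
   Lipschitz constants and bounds below refer to the latter. *)
Definition norm2 m (u : 'cV[R]_m) : R := Num.sqrt (dotv u u).

Definition opnorm2 m p (A : 'M[R]_(m, p)) : R :=
  sup [set norm2 (A *m u) | u in [set u : 'cV[R]_p | norm2 u <= 1]].

Definition grad m (f : 'cV[R]_m -> R) (x : 'cV[R]_m) : 'cV[R]_m :=
  \col_a 'D_(delta_mx a 0) (f : 'cV[R]_m -> R^o) x.

(* Transpose of the Jacobian: entry (a, b) is the partial derivative of the
   b-th component with respect to the a-th variable. *)
Definition gradmx m p (phi : 'cV[R]_m -> 'cV[R]_p) (x : 'cV[R]_m) :
    'M[R]_(m, p) :=
  \matrix_(a, b) ('D_(delta_mx a 0) phi x) b 0.

Definition is_argmin (T : Type) (A : set T) (h : T -> R) (s : T) : Prop :=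
  A s /\ forall t, A t -> h s <= h t.

End Euclidean.

Section AggregativeProblem.
Variables (R : realType) (N d : nat) (n : 'I_N -> nat).

(* A stacked vector col(x_1, ..., x_N) is the block column \mxcol_i x_i, and
   its i-th block is recovered by submxcol. *)
Local Notation stackx := 'cV[R]_(\sum_(i < N) n i).
Local Notation stackz := 'cV[R]_(\sum_(i < N) d).

Variable X : forall i : 'I_N, set 'cV[R]_(n i).
Variable phi : forall i : 'I_N, 'cV[R]_(n i) -> 'cV[R]_d.
(* g i (col_mx x z) is the paired form g_i(x, z). *)
Variable g : forall i : 'I_N, 'cV[R]_(n i + d) -> R.
Arguments X : clear implicits.
Arguments phi : clear implicits.
Arguments g : clear implicits.

Definition feasible : set stackx := [set x | forall i, X i (submxcol x i)].

Definition delta (x : stackx) : 'cV[R]_d :=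
  N%:R^-1 *: \sum_(i < N) phi i (submxcol x i).

Definition objective (x : stackx) : R :=
  \sum_(i < N) g i (col_mx (submxcol x i) (delta x)).

Definition gradx i (x : 'cV[R]_(n i)) (z : 'cV[R]_d) : 'cV[R]_(n i) :=
  grad (fun x' => g i (col_mx x' z)) x.

Definition gradz i (x : 'cV[R]_(n i)) (z : 'cV[R]_d) : 'cV[R]_d :=
  grad (fun z' => g i (col_mx x z')) z.

Definition grad1 (x : stackx) (z : stackz) : stackx :=
  \mxcol_(i < N) gradx (submxcol x i) (submxcol z i).

Definition grad2 (x : stackx) (z : stackz) : stackz :=
  \mxcol_(i < N) gradz (submxcol x i) (submxcol z i).

Record constraint_objective_assumption : Prop := {
  constraint_closed : forall i, closed (X i);
  constraint_convex : forall i, convex_set (X i);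
  constraint_compact : forall i, compact (X i);
  objective_convex : convex_function feasible objective;
  objective_differentiable : forall x, feasible x ->
    differentiable (objective : stackx -> R^o) x;
  objective_first_order : forall x y, feasible x -> feasible y ->
    dotv (y - x) (grad objective x) <= objective y - objective x;
  objective_smooth : exists L : R, forall x y, feasible x -> feasible y ->
    norm2 (grad objective x - grad objective y) <= L * norm2 (x - y)
}.

Record local_function_assumption : Prop := {
  grad1_lipschitz : exists l1 : R,
    forall (x : stackx) (z1 z2 : stackz), feasible x ->
    norm2 (grad1 x z1 - grad1 x z2) <= l1 * norm2 (z1 - z2);
  grad2_lipschitz : exists l2 : R,
    forall (x1 x2 : stackx) (z1 z2 : stackz), feasible x1 -> feasible x2 ->
    norm2 (grad2 x1 z1 - grad2 x2 z2)
      <= l2 * norm2 (x1 - x2) + l2 * norm2 (z1 - z2);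
  phi_differentiable : forall i x, X i x -> differentiable (phi i) x;
  phi_grad_bounded : exists c : 'I_N -> R,
    (forall i, 0 < c i) /\
    forall i x, X i x -> opnorm2 (gradmx (phi i) x) <= c i;
  phi_lipschitz : exists l3 : R,
    forall i x y, X i x -> X i y ->
    norm2 (phi i x - phi i y) <= l3 * norm2 (x - y)
}.

(* E k j i says that (j, i) is an edge at time k, that is, i can obtain
   information from j. *)
Variables (E : nat -> rel 'I_N) (W : nat -> 'M[R]_N).

Definition doubly_stochastic (A : 'M[R]_N) : Prop :=
  [/\ forall i j, 0 <= A i j,
      forall i, \sum_j A i j = 1 &
      forall j, \sum_i A i j = 1].

Definition union_graph (B k : nat) : rel 'I_N :=
  fun a b => [exists l : 'I_B, E (k + l.+1)%N a b].

Definition strongly_connected (e : rel 'I_N) : Prop :=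
  forall a b, connect e a b.

(* information_self: an agent always has access to its own information, so
   every node carries a self-loop. Without it, averaging need not lead to
   consensus (two agents swapping their values forever satisfy all the other
   fields). *)
Record network_assumption : Prop := {
  information_self : forall k i, E k i i;
  weight_pos : forall k i j, (0 < W k i j) <-> E k j i;
  weight_zero : forall k i j, ~~ E k j i -> W k i j = 0;
  weight_stochastic : forall k, doubly_stochastic (W k);
  weight_lower_bound : exists eta : R,
    [/\ 0 < eta, eta < 1 & forall k i j, E k j i -> eta <= W k i j];
  jointly_connected : exists B : nat,
    (0 < B)%N /\ forall k, strongly_connected (union_graph B k)
}.

Definition mix (k : nat) (u : 'I_N -> 'cV[R]_d) (i : 'I_N) : 'cV[R]_d :=
  \sum_(j < N | E k j i) W k i j *: u j.

(* The hatted variables of the (k+1)-st iteration are mix k (v k) and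
   mix k (y k). *)
Record projection_free_run (gamma : nat -> R)
    (x s : nat -> forall i : 'I_N, 'cV[R]_(n i))
    (v y : nat -> 'I_N -> 'cV[R]_d) : Prop := {
  run_x0 : forall i, X i (x 0%N i);
  run_v0 : forall i, v 0%N i = phi i (x 0%N i);
  run_y0 : forall i, y 0%N i = gradz (x 0%N i) (v 0%N i);
  run_s : forall k i,
    is_argmin (X i)
      (dotv (gradx (x k i) (mix k (v k) i)
             + gradmx (phi i) (x k i) *m mix k (y k) i))
      (s k i);
  run_x : forall k i,
    x k.+1 i = (1 - gamma k) *: x k i + gamma k *: s k i;
  run_v : forall k i,
    v k.+1 i = mix k (v k) i + phi i (x k.+1 i) - phi i (x k i);
  run_y : forall k i,
    y k.+1 i = mix k (y k) i + gradz (x k.+1 i) (v k.+1 i)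
               - gradz (x k i) (v k i)
}.

End AggregativeProblem.

(* Main.v *)
Require Import Defs.
From HB Require Import structures.
From mathcomp Require Import all_boot all_order all_algebra.
From mathcomp Require Import all_classical all_reals all_analysis.
From mathcomp Require Import lra ring.

Set Implicit Arguments.
Unset Strict Implicit.
Unset Printing Implicit Defensive.

Import Order.TTheory GRing.Theory Num.Theory.
Import numFieldNormedType.Exports.

Local Open Scope classical_set_scope.
Local Open Scope ring_scope.

(** The algorithm is a Frank-Wolfe method driven by an inexact gradient. Write
    h_k = f(x_k) - f(xstar) >= 0. Convexity is used at the new iterate,
      f(x_{k+1}) <= f(x_k) + <grad f(x_{k+1}), x_{k+1} - x_k>,
    and replacing grad f(x_{k+1}) by grad f(x_k) costs O(gamma_k^2), because
    the gradient is Lipschitz and the steps have length O(gamma_k). Each block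
    of s_k minimises the inner product with the estimated gradient over X_i, so
    its inner product is at most that of xstar; convexity once more turns
    <grad f(x_k), xstar - x_k> into -h_k. Altogether ([gap_descent])
      h_{k+1} <= (1 - gamma_k) h_k + gamma_k e_k,
    where e_k is O(gamma_k) plus a constant times the error of the gradient
    estimate. Since the gamma_k have infinite sum, such a weighted averaging
    makes h_k forget its past and follow e_k ([cvg0_averaging]): it is enough
    that e_k tends to 0, at any rate.

    The error of the estimate is controlled by two runs of dynamic average
    consensus. Over N * B steps the product of the doubly stochastic weights
    has all entries at least eta^(N * B) ([transition_ge_eta]), so it contracts
    the deviation from the average by a fixed factor in the l1-sum of the norms
    ([sum_norm_mix]). Hence averaging driven by a vanishing input reaches
    consensus ([consensus]), and a recursion that adds the increments of local
    signals tracks their mean as soon as these increments vanish ([tracking]).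
    The increments of phi_i(x_i) are O(gamma_k), so v tracks delta(x); then the
    increments of v vanish, hence so do those of the local gradients in z, and
    y tracks their mean. The chain rule ([dotv_grad_objective]) identifies the
    gradient of f as exactly the limit of these estimates
    ([gradient_error_cvg0]).

    Only boundedness and vanishing matter, so the hypotheses on Euclidean norms
    are transferred once to the sup norm, which is the norm of the normed space
    of column vectors. *)

(** * Null sequences *)

Lemma cvg_sum0 (R : numFieldType) (V : normedModType R) (I : finType)
    (f : I -> nat -> V) :
  (forall i, f i @ \oo --> 0) -> \sum_i f i k @[k --> \oo] --> 0.
Proof.
move=> f0; elim: (index_enum I) => [|i s IHs].
  by under eq_cvg do rewrite big_nil; exact: cvg_cst.
under eq_cvg do rewrite big_cons.
by have := cvgD (f0 i) IHs; rewrite addr0; apply.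
Qed.

Lemma cvg0D (R : numFieldType) (V : normedModType R) (f h : nat -> V) :
  f @ \oo --> 0 -> h @ \oo --> 0 -> f k + h k @[k --> \oo] --> 0.
Proof. by move=> f0 h0; rewrite -(addr0 (0 : V)); exact: cvgD. Qed.

Lemma cvg0_scale (R : realType) (c : R) (h : nat -> R) :
  h @ \oo --> 0 -> c * h k @[k --> \oo] --> 0.
Proof. by move=> h0; rewrite -(mulr0 c); exact: cvgMr. Qed.

Lemma cvg0_norm (R : realType) (V : normedModType R) (f : nat -> V) :
  f @ \oo --> 0 -> `|f k| @[k --> \oo] --> (0 : R).
Proof. by move=> f0; rewrite -(normr0 V); exact: cvg_norm. Qed.

Lemma cvg0_le (R : realType) (V : normedModType R) (f : nat -> V)
    (h : nat -> R) :
  (forall k, `|f k| <= h k) -> h @ \oo --> 0 -> f @ \oo --> 0.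
Proof.
move=> fh h0; apply/cvgr0Pnorm_lt => eps eps0.
have /cvgr0Pnorm_lt/(_ _ eps0) := h0; apply: filterS => k.
by apply: le_lt_trans; apply: le_trans (fh k) (ler_norm _).
Qed.

Lemma cvg0_sum_norm (R : realType) (V : normedModType R) (I : finType)
    (f : I -> nat -> V) :
  (forall i, f i @ \oo --> 0) -> \sum_i `|f i k| @[k --> \oo] --> (0 : R).
Proof.
by move=> f0; apply: cvg_sum0 => i; exact: cvg0_norm.
Qed.

Lemma nneseries_pinfty_unbounded (R : realType) (t : nat -> R) :
  (forall k, 0 <= t k) -> (\sum_(0 <= k <oo) (t k)%:E = +oo)%E ->
  forall M, exists m, M <= \sum_(k < m) t k.
Proof.
move=> t0 tdiv M; apply/not_existsP => tM.
have : (\sum_(0 <= k <oo) (t k)%:E <= M%:E)%E.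
  apply: lime_le; first by apply: is_cvg_nneseries => k _ _; rewrite lee_fin.
  apply: nearW => m; rewrite big_mkord sumEFin lee_fin ltW// ltNge.
  exact/negP/tM.
by rewrite tdiv leye_eq.
Qed.

(** A nonincreasing sequence that stays above eps has squares of sum at least
    m * eps^2 for every m. *)
Lemma nonincreasing_square_summable_cvg0 (R : realType) (t : nat -> R) :
  (forall k, 0 <= t k) -> (forall k, t k.+1 <= t k) ->
  (\sum_(0 <= k <oo) ((t k) ^+ 2)%:E < +oo)%E -> t @ \oo --> 0.
Proof.
move=> t0 tdecr tsum; apply/cvgr0Pnorm_lt => eps eps0.
have [K tK] : exists K, t K < eps.
  apply/not_existsP => teps.
  have : (0%E <= \sum_(0 <= k <oo) ((t k) ^+ 2)%:E)%E.
    by apply: nneseries_ge0 => k _ _; rewrite lee_fin sqr_ge0.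
  have le_sum m : (((eps ^+ 2) * m%:R)%:E
      <= \sum_(0 <= k <oo) ((t k) ^+ 2)%:E)%E.
    apply: le_trans (nneseries_lim_ge m _); last first.
      by move=> k _ _; rewrite lee_fin sqr_ge0.
    rewrite big_mkord sumEFin lee_fin mulr_natr -[in leLHS](card_ord m).
    rewrite -sumr_const; apply: ler_sum => k _.
    by rewrite ler_sqr ?nnegrE ?(ltW eps0)// leNgt; apply/negP/teps.
  case: (\sum_(0 <= k <oo) _)%E le_sum tsum => [r| |]//= le_sum _.
  rewrite lee_fin => r0.
  have eps20 : 0 < eps ^+ 2 by rewrite exprn_gt0.
  have := le_sum (Num.bound (r / eps ^+ 2)).
  rewrite lee_fin leNgt mulrC -ltr_pdivrMr// archi_boundP//.
  by rewrite divr_ge0// ltW.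
exists K => // k /= Kk; rewrite ger0_norm//; apply: le_lt_trans tK.
rewrite -(subnKC Kk); elim: (k - K)%N => [|l IHl]; first by rewrite addn0.
by rewrite addnS (le_trans (tdecr _)).
Qed.

(** With w_k the part of a_k above a level that eventually dominates e_k, the
    recursion gives w_{k+1} <= (1 - t_k) w_k. As (1 - t)(1 + S + t) <= 1 + S,
    the quantity w_k (1 + t_K + ... + t_{k-1}) never increases, and the second
    factor tends to infinity. *)
Lemma cvg0_averaging (R : realType) (a t e : nat -> R) :
  (forall k, 0 <= a k) -> (forall k, 0 <= t k <= 1) ->
  (forall M, exists m, M <= \sum_(k < m) t k) ->
  e @ \oo --> 0 ->
  (forall k, a k.+1 <= (1 - t k) * a k + t k * e k) ->
  a @ \oo --> 0.
Proof.
move=> a0 t01 tdiv e0 arec; apply/cvgr0Pnorm_lt => eps eps0.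
have eps20 : 0 < eps / 2 by rewrite divr_gt0.
have /cvgr0Pnorm_lt/(_ _ eps20)[K _ eK] := e0.
pose w k := Num.max (a k - eps / 2) 0.
have w0 k : 0 <= w k by rewrite le_max lexx orbT.
have wrec k : (K <= k)%N -> w k.+1 <= (1 - t k) * w k.
  move=> Kk; have /andP[tk0 tk1] := t01 k.
  have ek : e k <= eps / 2 by apply: le_trans (ler_norm _) (ltW (eK _ Kk)).
  rewrite ge_max mulr_ge0 ?subr_ge0// andbT.
  have wk : a k - eps / 2 <= w k by rewrite le_max lexx.
  have := arec k; have := ler_wpM2l tk0 ek.
  have := ler_wpM2l (_ : 0 <= 1 - t k) wk; rewrite subr_ge0 => /(_ tk1).
  lra.
have S0 m : 0 <= \sum_(l < m) t (K + l)%N.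
  by apply: sumr_ge0 => l _; have /andP[] := t01 (K + l)%N.
have wS m : w (K + m)%N * (1 + \sum_(l < m) t (K + l)%N) <= w K.
  elim: m => [|m IHm]; first by rewrite big_ord0 addr0 mulr1 addn0.
  apply: le_trans IHm; rewrite big_ord_recr/= addnS.
  have /andP[tk0 tk1] := t01 (K + m)%N.
  have := wrec (K + m)%N (leq_addr _ _).
  have := S0 m; move: (\sum_(l < m) _) (w0 (K + m)%N) => S.
  move: (w (K + m)%N) (w (K + m).+1) (t (K + m)%N) tk0 tk1 => w1 w2 t1.
  move=> t10 t11 w10 S00 w12.
  apply: (@le_trans _ _ ((1 - t1) * w1 * (1 + (S + t1)))).
    by rewrite ler_wpM2r// addr_ge0// addr_ge0.
  rewrite -subr_ge0.
  rewrite (_ : _ - _ = w1 * (t1 * (S + t1))); last by ring.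
  by rewrite !mulr_ge0// addr_ge0.
have sumS m p : \sum_(k < m + p) t k
    = \sum_(k < m) t k + \sum_(l < p) t (m + l)%N by rewrite big_split_ord.
have [m0 Mm0] := tdiv (\sum_(k < K) t k + w K / (eps / 2)).
exists (maxn m0 K) => // j /=; rewrite geq_max => /andP[m0j Kj].
rewrite ger0_norm// ltNge; apply/negP => epsa.
have := wS (j - K)%N; rewrite subnKC//.
have : w K / (eps / 2) <= \sum_(l < j - K) t (K + l)%N.
  rewrite -(lerD2l (\sum_(k < K) t k)) (le_trans Mm0)//.
  rewrite -sumS subnKC// -(subnKC m0j) sumS lerDl sumr_ge0// => i _.
  by have /andP[] := t01 (m0 + i)%N.
rewrite ler_pdivrMr//.
have : eps / 2 <= w j by rewrite le_max; apply/orP; left; lra.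
have := S0 (j - K)%N; move: (\sum_(l < _) _) => S S00 wj KS.
have := ler_wpM2r (_ : 0 <= 1 + S) wj; rewrite addr_ge0// => /(_ isT).
lra.
Qed.

Lemma cvg0_subsequences (R : realType) (T : nat) (b : nat -> R) :
  (0 < T)%N -> (forall r : 'I_T, b (r + m * T)%N @[m --> \oo] --> 0) ->
  b @ \oo --> 0.
Proof.
move=> T0 bT; apply/cvgr0Pnorm_lt => eps eps0.
have [M _ bM] : \forall m \near \oo, forall r : 'I_T, `|b (r + m * T)%N| < eps.
  apply: filter_forall => r.
  by have /cvgr0Pnorm_lt/(_ _ eps0) := bT r.
exists (M * T)%N => // k /= Mk.
have := bM (k %/ T)%N _ (Ordinal (ltn_pmod k T0)) => /=.
by rewrite addnC -divn_eq; apply; rewrite leq_divRL.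
Qed.

(** Along each residue class modulo T the sequence is an averaging with
    constant weight q. *)
Lemma cvg0_window_contraction (R : realType) (T : nat) (q : R)
    (b e : nat -> R) :
  (0 < T)%N -> 0 < q <= 1 -> (forall k, 0 <= b k) -> e @ \oo --> 0 ->
  (forall k, b (k + T)%N <= (1 - q) * b k + e k) ->
  b @ \oo --> 0.
Proof.
move=> T0 /andP[q0 q1] b0 e0 brec; apply: (@cvg0_subsequences _ T) => // r.
apply: (@cvg0_averaging _ _ (fun=> q) (fun m => q^-1 * e (r + m * T)%N)) => //.
- by move=> _; rewrite ltW.
- move=> M; pose m := Num.bound `|M / q|.
  have Mm : M / q <= m%:R by rewrite (le_trans (ler_norm _))// ltW// archi_boundP.
  by exists m; rewrite sumr_const card_ord -mulr_natl -ler_pdivrMr.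
- rewrite -(mulr0 q^-1); apply: cvgMr.
  apply: cvg_comp e0 => A [M _ MA]; exists M => // m /= Mm; apply: MA => /=.
  by rewrite (leq_trans Mm)// (leq_trans _ (leq_addl _ _))// leq_pmulr.
- by move=> m; rewrite mulVKf ?gt_eqF// mulSnr addnA.
Qed.

(** * Consensus over jointly connected graphs *)

Section Consensus.
Variables (R : realType) (N : nat).
Implicit Types (A : 'M[R]_N) (E : nat -> rel 'I_N) (W : nat -> 'M[R]_N).

(** The product W_{k+t-1} ... W_k, which maps the values at time k to the
    values reached at time k + t by averaging alone. *)
Fixpoint transition W (k t : nat) : 'M[R]_N :=
  if t is t'.+1 then W (k + t')%N *m transition W k t' else 1%:M.

Lemma transition_ge0 W k t : (forall k, doubly_stochastic (W k)) ->
  forall i j, 0 <= transition W k t i j.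
Proof.
move=> dsW; elim: t => [|t IHt] i j /=; first by rewrite mxE ler0n.
by rewrite mxE sumr_ge0// => p _; rewrite mulr_ge0//; case: (dsW (k + t)%N).
Qed.

Lemma transition_col W k t : (forall k, doubly_stochastic (W k)) ->
  forall j, \sum_i transition W k t i j = 1.
Proof.
move=> dsW; elim: t => [|t IHt] j /=.
  rewrite (bigD1 j)//= mxE eqxx big1 ?addr0// => i ij.
  by rewrite mxE (negbTE ij).
under eq_bigr do rewrite mxE.
rewrite exchange_big/= -[RHS](IHt j); apply: eq_bigr => p _.
by rewrite -mulr_suml; case: (dsW (k + t)%N) => _ _ ->; rewrite mul1r.
Qed.

Lemma connect_crossing_edge (T : finType) (e : rel T) (S : {set T}) a b :
  connect e a b -> a \in S -> b \notin S ->
  exists p q, [/\ p \in S, q \notin S & e p q].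
Proof.
case/connectP => s; elim: s a => [|c s IHs] a /=; first by move=> _ -> ->.
case/andP => eac ps lb aS bS; have [cS|cS] := boolP (c \in S).
  exact: IHs cS bS.
by exists a, c.
Qed.

(** The agents i that have received at least the share eta^t of the value of j
    after t steps form a set S t. It is nondecreasing because of the self-loops,
    and as long as it is not everything, joint connectivity provides within B
    steps an edge leaving it, whose head joins the set. After N such periods it
    contains all agents. *)
Lemma transition_ge_eta E W B (eta : R) k j :
  (forall k, doubly_stochastic (W k)) -> (forall k i, E k i i) ->
  0 < eta -> (forall k i j, E k j i -> eta <= W k i j) ->
  (forall k, strongly_connected (union_graph E B k)) ->
  forall i, eta ^+ (N * B) <= transition W k.+1 (N * B) i j.
Proof.
move=> dsW Eself eta0 etaW conn.
(* The walk starts at k.+1 because the union graph of index k starts there. *)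
pose S t : {set 'I_N} := [set i | eta ^+ t <= transition W k.+1 t i j]%SET.
have Sedge t p i : p \in S t -> E (k.+1 + t)%N p i -> i \in S t.+1.
  rewrite !inE /= mxE => pS /etaW etaWip.
  rewrite (bigD1 p)//= exprS ler_wpDr//.
    rewrite sumr_ge0// => q _; rewrite mulr_ge0//.
      by case: (dsW (k.+1 + t)%N).
    exact: transition_ge0.
  by rewrite ler_pM// ?exprn_ge0// ltW.
have SS t : S t \subset S t.+1.
  by apply/fintype.subsetP => i iS; apply: Sedge iS _.
have Smono t t' : (t <= t')%N -> S t \subset S t'.
  move=> /subnKC <-; elim: (t' - t)%N => [|l IHl]; first by rewrite addn0.
  by rewrite addnS (fintype.subset_trans IHl).
have jS t : j \in S t.
  apply: (fintype.subsetP (Smono _ _ (leq0n t))).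
  by rewrite inE /= expr0 mxE eqxx.
have grow q : (q < #|S (q * B)|)%N || (S (q * B) == [set: 'I_N]%SET).
  elim: q => [|q IHq]; first
    by rewrite card_gt0; apply/orP; left; apply/set0Pn; exists j.
  have [ST|SnT] := eqVneq (S (q * B)%N) [set: 'I_N]%SET.
    apply/orP; right; rewrite -finset.subTset -ST.
    by rewrite Smono// leq_mul2r leqnSn orbT.
  rewrite (negbTE SnT) orbF in IHq.
  have [b bS] : exists b, b \notin S (q * B)%N.
    move: SnT; rewrite -finset.subTset => /fintype.subsetPn[b _ bS]; by exists b.
  have [p [i [pS iS /existsP[l Epi]]]] :=
    connect_crossing_edge (conn (k + q * B)%N j b) (jS _) bS.
  apply/orP; left; rewrite (leq_ltn_trans IHq)// proper_card//.
  apply/fintype.properP; split; first by rewrite Smono// leq_mul2r leqnSn orbT.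
  exists i => //.
  apply: (fintype.subsetP (Smono (q * B + l).+1 _ _)).
    by rewrite mulSnr -addnS leq_add2l.
  apply: Sedge (fintype.subsetP (Smono _ _ (leq_addr _ _)) _ pS) _.
  by move: Epi; rewrite addSn addnA addnS.
move=> i; have : i \in S (N * B)%N; last by rewrite inE.
have /orP[|/eqP->] := grow N; last by rewrite inE.
by move=> /leq_trans/(_ (max_card _)); rewrite card_ord ltnn.
Qed.

Variable V : normedModType R.
Implicit Types u r : 'I_N -> V.

(** Once c times the sum of u vanishes, subtracting the constant c from every
    entry of A leaves the result unchanged, while the entries stay nonnegative
    and the column sums drop to 1 - N c. The case c = 0, with no condition on
    u, says that averaging does not increase the sum of the norms; the case of
    zero-sum u is the contraction towards consensus. *)
Lemma sum_norm_mix A u (c : R) :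
  (forall i j, c <= A i j) -> (forall j, \sum_i A i j = 1) ->
  c *: \sum_j u j = 0 ->
  \sum_i `|\sum_j A i j *: u j| <= (1 - N%:R * c) * \sum_j `|u j|.
Proof.
move=> cA colA cu0.
have -> : (1 - N%:R * c) * \sum_j `|u j| = \sum_i \sum_j (A i j - c) * `|u j|.
  rewrite exchange_big/= mulr_sumr; apply: eq_bigr => j _.
  by rewrite -mulr_suml sumrB colA sumr_const card_ord mulr_natl.
apply: ler_sum => i _.
have -> : \sum_j A i j *: u j = \sum_j (A i j - c) *: u j.
  under [RHS]eq_bigr do rewrite scalerBl.
  by rewrite sumrB -scaler_sumr cu0 subr0.
apply: le_trans (ler_norm_sum _ _ _) _; apply: ler_sum => j _.
by rewrite normrZ ger0_norm ?subr_ge0.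
Qed.

Definition disagreement u i := u i - N%:R^-1 *: \sum_j u j.

Lemma sum_disagreement u : \sum_i disagreement u i = 0.
Proof.
rewrite sumrB sumr_const card_ord -scaler_nat scalerA.
have [N0|N0] := posnP N; last first.
  by rewrite mulfV ?pnatr_eq0 ?gtn_eqF// scale1r subrr.
rewrite !big1 ?scaler0 ?subr0// => i; by have := ltn_ord i; rewrite {2}N0.
Qed.

Lemma disagreement_mix A u r : doubly_stochastic A ->
  forall i, disagreement (fun i => \sum_j A i j *: u j + r i) i =
    \sum_j A i j *: disagreement u j + disagreement r i.
Proof.
move=> [_ rowA colA] i; rewrite /disagreement big_split/=.
under [\sum_j A i j *: (_ - _)]eq_bigr do rewrite scalerBr.
rewrite sumrB -scaler_suml rowA scale1r exchange_big/=.
under [\sum_j \sum_i0 _]eq_bigr do rewrite -scaler_suml colA scale1r.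
by rewrite scalerDr opprD addrACA.
Qed.

(** The deviations from the average sum to zero and satisfy the same recursion
    as u, driven by the deviations of the input. Over a window of N * B steps
    they are contracted, up to the inputs received in between. *)
Lemma consensus E W (u r : nat -> 'I_N -> V) :
  network_assumption E W ->
  (forall k i, u k.+1 i = \sum_j W k i j *: u k j + r k i) ->
  (forall i, r k i @[k --> \oo] --> 0) ->
  forall i, disagreement (u k) i @[k --> \oo] --> 0.
Proof.
move=> [Eself _ _ dsW [eta [eta0 eta1 etaW]] [B [B0 conn]]] urec r0.
pose e k := disagreement (u k).
pose b k := \sum_i `|e k i|.
pose rho k := \sum_i `|disagreement (r k) i|.
have erec k i : e k.+1 i = \sum_j W k i j *: e k j + disagreement (r k) i.
  rewrite /e (_ : u k.+1 = fun i => \sum_j W k i j *: u k j + r k i).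
    exact: disagreement_mix.
  by apply/funext => p; exact: urec.
have rho0 : rho @ \oo --> 0.
  apply: cvg_sum0 => i; rewrite -(normr0 V); apply: cvg_norm.
  rewrite -(subr0 (0 : V)) -{2}(scaler0 V N%:R^-1).
  apply: cvgB; first exact: r0.
  apply: cvgZr.
  by apply: cvg_sum0 => j; exact: r0.
(* Inputs received during the window are never amplified by later averaging. *)
have dev k t : \sum_i `|e (k + t)%N i - \sum_j transition W k t i j *: e k j|
    <= \sum_(l < t) rho (k + l)%N.
  elim: t => [|t IHt] /=.
    rewrite big_ord0 big1// => i _; rewrite addn0 (bigD1 i)//= mxE eqxx scale1r.
    rewrite big1 ?addr0 ?subrr ?normr0// => j ji.
    by rewrite mxE eq_sym (negbTE ji) scale0r.
  rewrite big_ord_recr/= addnS.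
  pose f i := e (k + t)%N i - \sum_j transition W k t i j *: e k j.
  have -> : \sum_i `|e (k + t).+1 i
              - \sum_j (W (k + t)%N *m transition W k t) i j *: e k j|
      = \sum_i `|\sum_p W (k + t)%N i p *: f p + disagreement (r (k + t)%N) i|.
    apply: eq_bigr => i _; rewrite erec; congr `|_|.
    under [\sum_p _ *: f p]eq_bigr do rewrite scalerBr.
    rewrite sumrB addrAC; congr (_ - _ + _).
    under eq_bigr do rewrite mxE scaler_suml.
    rewrite exchange_big/=; apply: eq_bigr => p _.
    by rewrite scaler_sumr; apply: eq_bigr => j _; rewrite scalerA.
  apply: (@le_trans _ _ (\sum_i (`|\sum_p W (k + t)%N i p *: f p|
                           + `|disagreement (r (k + t)%N) i|))).
    by apply: ler_sum => i _; exact: ler_normD.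
  rewrite big_split/= lerD2r; apply: le_trans IHt.
  have := @sum_norm_mix (W (k + t)%N) f 0; rewrite mulr0 subr0 mul1r scale0r.
  by apply => //; case: (dsW (k + t)%N).
have bN k i : `|e k i| <= b k.
  by rewrite /b (bigD1 i)//= lerDl sumr_ge0.
suff b0 : b @ \oo --> 0.
  move=> i; apply/cvgr0Pnorm_lt => eps eps0.
  have /cvgr0Pnorm_lt/(_ _ eps0) := b0; apply: filterS => k.
  by apply: le_lt_trans; apply: le_trans (bN k i) (ler_norm _).
have [N0|N0] := posnP N.
  rewrite (_ : b = fun=> 0); first exact: cvg_cst.
  apply/funext => k; rewrite /b big1// => i; by have := ltn_ord i; rewrite {2}N0.
(* The lower bound on the entries holds for products that start
   at time 1 or later. *)
rewrite -(cvg_shiftS b).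
pose T := (N * B)%N; pose c := eta ^+ T.
have cT k i j : c <= transition W k.+1 T i j.
  exact: (transition_ge_eta k j dsW Eself eta0 etaW conn).
apply: (@cvg0_window_contraction _ T (N%:R * c) _
  (fun k => \sum_(l < T) rho (k.+1 + l)%N)).
- by rewrite muln_gt0 N0.
- rewrite mulr_gt0 ?exprn_gt0 ?ltr0n//=.
  have -> : N%:R * c = \sum_(i < N) c by rewrite sumr_const card_ord mulr_natl.
  rewrite -(transition_col 1 T dsW (Ordinal N0)).
  by apply: ler_sum => i _.
- by move=> k; rewrite /= sumr_ge0.
-  apply: cvg_sum0 => l.
  rewrite (_ : (fun k => _) = fun k => rho (k + l.+1)%N); last first.
    by apply/funext => k; rewrite addSnnS.
  by rewrite cvg_shiftn.
- move=> k; rewrite /= -addSn.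
  have := @sum_norm_mix (transition W k.+1 T) (e k.+1) c (cT k)
            (transition_col _ _ dsW).
  rewrite sum_disagreement scaler0 => /(_ erefl) H.
  apply: le_trans (lerD H (dev k.+1 T)).
  rewrite -big_split/=; apply: ler_sum => i _.
  by rewrite -{1}(addrNK (\sum_j transition W k.+1 T i j *: e k.+1 j)
                    (e (k.+1 + T)%N i)) addrC ler_normD.
Qed.

End Consensus.

(** * Tracking the mean of varying signals *)

Section Tracking.
Variables (R : realType) (N : nat) (V : normedModType R).
Variables (E : nat -> rel 'I_N) (W : nat -> 'M[R]_N).
Hypothesis net : network_assumption E W.
Variables u p : nat -> 'I_N -> V.
Hypothesis u0 : forall i, u 0%N i = p 0%N i.
Hypothesis urec : forall k i,
  u k.+1 i = \sum_j W k i j *: u k j + p k.+1 i - p k i.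

Local Notation mean w := (N%:R^-1 *: \sum_j w j).

(** Averaging preserves the total because the columns of W sum to 1, so the
    increments telescope. *)
Lemma tracking_sum k : \sum_i u k i = \sum_i p k i.
Proof.
elim: k => [|k IHk]; first by apply: eq_bigr => i _; exact: u0.
under eq_bigr do rewrite urec.
rewrite sumrB big_split/= exchange_big/=.
under eq_bigr do rewrite -scaler_suml.
have colW j : \sum_i W k i j = 1 by case: (weight_stochastic net k).
under eq_bigr do rewrite colW scale1r.
by rewrite IHk addrAC subrr add0r.
Qed.

Hypothesis pstep : forall i, p k.+1 i - p k i @[k --> \oo] --> 0.

Lemma tracking i : u k i - mean (p k) @[k --> \oo] --> 0.
Proof.
have uc : disagreement (u k) i @[k --> \oo] --> 0.
  apply: (@consensus _ _ _ _ _ u (fun k i => p k.+1 i - p k i) net) => // k j.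
  by rewrite urec addrA.
apply: cvg_trans uc; apply: near_eq_cvg.
by apply: nearW => k; rewrite -tracking_sum.
Qed.

Lemma tracking_mixed i :
  \sum_j W k i j *: u k j - mean (p k) @[k --> \oo] --> 0.
Proof.
apply: cvg0_le (cvg0_sum_norm tracking) => k.
have [W0 rowW _] := weight_stochastic net k.
have -> : \sum_j W k i j *: u k j - mean (p k) =
    \sum_j W k i j *: (u k j - mean (p k)).
  under [RHS]eq_bigr do rewrite scalerBr.
  by rewrite sumrB -scaler_suml rowW scale1r.
apply: le_trans (ler_norm_sum _ _ _) _; apply: ler_sum => j _.
rewrite normrZ ger0_norm// ler_piMl// -(rowW i) (bigD1 j)//= lerDl.
by rewrite sumr_ge0.
Qed.

Lemma tracking_step i : u k.+1 i - u k i @[k --> \oo] --> 0.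
Proof.
have H : (\sum_j W k i j *: u k j - mean (p k)) + (p k.+1 i - p k i)
    - (u k i - mean (p k)) @[k --> \oo] --> (0 + 0 - 0 : V).
  apply: cvgB (tracking i); apply: cvgD; first exact: tracking_mixed.
  exact: pstep.
rewrite addr0 subr0 in H; apply: cvg_trans H; apply: near_eq_cvg.
by apply: nearW => k; rewrite /= urec opprB addrAC subrKA addrAC addrA.
Qed.

End Tracking.

(** * Euclidean and sup norms *)

Section EuclideanAndSupNorm.
Variable R : realType.

Lemma entry_le_norm m p (A : 'M[R]_(m, p)) i j : `|A i j| <= `|A|.
Proof.
rewrite [leRHS]/Num.norm/= mx_normrE.
exact: (le_bigmax _ (fun ij : 'I_m * 'I_p => `|A ij.1 ij.2|) (i, j)).
Qed.

Lemma norm_le_entries m p (A : 'M[R]_(m, p)) c :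
  0 <= c -> (forall i j, `|A i j| <= c) -> `|A| <= c.
Proof.
by move=> c0 Ac; rewrite /Num.norm/= mx_normrE; apply: bigmax_le => // -[i j] _.
Qed.

Lemma sum_ord_le p (F : 'I_p -> R) c :
  (forall a, F a <= c) -> \sum_a F a <= p%:R * c.
Proof.
move=> Fc; have -> : p%:R * c = \sum_(a < p) c.
  by rewrite sumr_const card_ord mulr_natl.
by apply: ler_sum => a _.
Qed.

Lemma dotvE m (u v : 'cV[R]_m) : dotv u v = \sum_a u a 0 * v a 0.
Proof. by rewrite /dotv mxE; apply: eq_bigr => a _; rewrite mxE. Qed.

Lemma dotvC m (u v : 'cV[R]_m) : dotv u v = dotv v u.
Proof. by rewrite !dotvE; apply: eq_bigr => a _; rewrite mulrC. Qed.

Lemma dotvDl m (u v w : 'cV[R]_m) : dotv (u + v) w = dotv u w + dotv v w.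
Proof. by rewrite /dotv linearD/= mulmxDl mxE. Qed.

Lemma dotvZl m c (u w : 'cV[R]_m) : dotv (c *: u) w = c * dotv u w.
Proof. by rewrite /dotv linearZ/= -scalemxAl mxE. Qed.

Lemma dotvBl m (u v w : 'cV[R]_m) : dotv (u - v) w = dotv u w - dotv v w.
Proof. by rewrite dotvDl -scaleN1r dotvZl mulN1r. Qed.

Lemma dotvBr m (u v w : 'cV[R]_m) : dotv w (u - v) = dotv w u - dotv w v.
Proof. by rewrite !(dotvC w) dotvBl. Qed.

Lemma dotvZr m c (u w : 'cV[R]_m) : dotv w (c *: u) = c * dotv w u.
Proof. by rewrite !(dotvC w) dotvZl. Qed.

Lemma dotv_suml m I (r : seq I) (u : I -> 'cV[R]_m) w :
  dotv (\sum_(i <- r) u i) w = \sum_(i <- r) dotv (u i) w.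
Proof. by rewrite /dotv linear_sum/= mulmx_suml summxE. Qed.

Lemma dotv_sumr m I (r : seq I) (u : I -> 'cV[R]_m) w :
  dotv w (\sum_(i <- r) u i) = \sum_(i <- r) dotv w (u i).
Proof. by rewrite dotvC dotv_suml; apply: eq_bigr => i _; rewrite dotvC. Qed.

Lemma dotv_mulmxl m p (A : 'M[R]_(m, p)) u w :
  dotv (A *m u) w = dotv u (A^T *m w).
Proof. by rewrite /dotv trmx_mul mulmxA. Qed.

Lemma dotv_le_norm m (u v : 'cV[R]_m) : `|dotv u v| <= m%:R * `|u| * `|v|.
Proof.
rewrite dotvE -mulrA (le_trans (ler_norm_sum _ _ _))//.
apply: sum_ord_le => a.
by rewrite normrM ler_pM// entry_le_norm.
Qed.

Lemma dotv_ge0 m (u : 'cV[R]_m) : 0 <= dotv u u.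
Proof. by rewrite dotvE sumr_ge0// => a _; rewrite -expr2 sqr_ge0. Qed.

Lemma norm_le_norm2 m (u : 'cV[R]_m) : `|u| <= norm2 u.
Proof.
apply: norm_le_entries => [|a b]; first exact: sqrtr_ge0.
rewrite ord1 /norm2 -sqrtr_sqr ler_sqrt ?dotv_ge0// dotvE (bigD1 a)//=.
by rewrite expr2 lerDl sumr_ge0// => c _; rewrite -expr2 sqr_ge0.
Qed.

Lemma norm2_le_norm m (u : 'cV[R]_m) : norm2 u <= m%:R * `|u|.
Proof.
rewrite -[leRHS]ger0_norm ?mulr_ge0// -sqrtr_sqr ler_sqrt ?sqr_ge0//.
apply: le_trans (ler_norm _) _; apply: le_trans (dotv_le_norm u u) _.
rewrite exprMn expr2 -mulrA -expr2 ler_wpM2r ?sqr_ge0//.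
by rewrite -natrM ler_nat; case: m u => // m _; rewrite leq_pmulr.
Qed.

Lemma scaled_norm2_le_norm m (L : R) (u : 'cV[R]_m) :
  L * norm2 u <= `|L| * m%:R * `|u|.
Proof.
apply: (@le_trans _ _ (`|L| * norm2 u)).
  by rewrite ler_wpM2r ?sqrtr_ge0// ler_norm.
by rewrite -mulrA ler_wpM2l// norm2_le_norm.
Qed.

Lemma lipschitz_norm2_norm m p (w : 'cV[R]_p) (u : 'cV[R]_m) (L : R) :
  norm2 w <= L * norm2 u -> `|w| <= (`|L| * m%:R) * `|u|.
Proof.
move=> wL; apply: le_trans (norm_le_norm2 w) _.
exact: le_trans wL (scaled_norm2_le_norm L u).
Qed.

Lemma norm_mulmx m p q (A : 'M[R]_(m, p)) (B : 'M[R]_(p, q)) :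
  `|A *m B| <= p%:R * `|A| * `|B|.
Proof.
apply: norm_le_entries => [|i j]; first by rewrite !mulr_ge0.
rewrite mxE -mulrA (le_trans (ler_norm_sum _ _ _))//.
apply: sum_ord_le => a.
by rewrite normrM ler_pM// entry_le_norm.
Qed.

(** Each entry is bounded by the image of a unit vector; the set in the
    definition of the operator norm must be bounded for its supremum to be an
    upper bound. *)
Lemma norm_le_opnorm2 m p (A : 'M[R]_(m, p)) c :
  0 <= c -> opnorm2 A <= c -> `|A| <= c.
Proof.
move=> c0 Ac; apply: norm_le_entries => // a b; apply: le_trans Ac.
pose U := [set norm2 (A *m u) | u in [set u : 'cV[R]_p | norm2 u <= 1]].
have ubU : has_ubound U.
  exists (m%:R * (p%:R * `|A|)) => _ [u /= u1 <-].
  apply: le_trans (norm2_le_norm _) _; rewrite ler_wpM2l//.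
  apply: le_trans (norm_mulmx _ _) _; rewrite ler_piMr ?mulr_ge0//.
  exact: le_trans (norm_le_norm2 u) u1.
apply: (@le_trans _ _ (norm2 (A *m delta_mx b (0 : 'I_1)))).
  rewrite -colE; apply: le_trans (norm_le_norm2 _).
  by have := entry_le_norm (col b A) a 0; rewrite mxE.
apply: ub_le_sup => //; exists (delta_mx b 0) => //=.
rewrite /norm2 dotvE (bigD1 b)//= big1 ?addr0.
  by rewrite !mxE !eqxx mulr1 sqrtr1.
by move=> i ib; rewrite !mxE (negbTE ib) mul0r.
Qed.

Lemma norm_submxcol N (n : 'I_N -> nat) (u : 'cV[R]_(\sum_(i < N) n i)) i :
  `|submxcol u i| <= `|u|.
Proof.
by apply: norm_le_entries => // a b; rewrite ord1 mxE entry_le_norm.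
Qed.

Lemma norm_le_blocks N (n : 'I_N -> nat) (u : 'cV[R]_(\sum_(i < N) n i)) c :
  0 <= c -> (forall i, `|submxcol u i| <= c) -> `|u| <= c.
Proof.
move=> c0 uc; rewrite -(submxcolK u); apply: norm_le_entries => // a b.
by rewrite mxE; exact: le_trans (entry_le_norm _ _ _) (uc _).
Qed.

End EuclideanAndSupNorm.

(** * Gradients and the chain rule *)

Section Gradients.
Variable R : realType.

Lemma mulmx_continuous m p q (A : 'M[R]_(m, p)) :
  continuous (mulmx A : 'M[R]_(p, q) -> 'M[R]_(m, q)).
Proof.
apply/linear_bounded_continuous/linear_boundedP.
exists (p%:R * `|A|); split; first by rewrite realM// ?realn ?normr_real.
move=> M AM u; apply: le_trans (norm_mulmx A u) _.
by rewrite ler_wpM2r// ltW.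
Qed.

Lemma differentiable_mulmx m p q (A : 'M[R]_(m, p)) (x : 'M[R]_(p, q)) :
  differentiable (mulmx A : 'M[R]_(p, q) -> 'M[R]_(m, q)) x.
Proof. exact/linear_differentiable/mulmx_continuous. Qed.

Lemma diff_mulmx m p q (A : 'M[R]_(m, p)) (x w : 'M[R]_(p, q)) :
  'd (mulmx A : 'M[R]_(p, q) -> 'M[R]_(m, q)) x w = A *m w.
Proof. by rewrite diff_lin//; exact: mulmx_continuous. Qed.

Lemma diffD_app (V W : normedModType R) (f h : V -> W) x w :
  differentiable f x -> differentiable h x ->
  'd (f + h) x w = 'd f x w + 'd h x w.
Proof. by move=> df dh; rewrite diffD. Qed.

Lemma diff_cst_app (V W : normedModType R) (b : W) (x w : V) :
  'd (cst b) x w = 0.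
Proof. by rewrite diff_cst. Qed.

Lemma diff_affine m p q (A : 'M[R]_(m, p)) (b : 'M[R]_(m, q)) x w :
  'd ((mulmx A : 'M[R]_(p, q) -> 'M[R]_(m, q)) + cst b) x w = A *m w.
Proof.
rewrite diffD_app//; last exact: differentiable_mulmx.
rewrite -[RHS]addr0.
by congr (_ + _); [exact: diff_mulmx|exact: diff_cst_app].
Qed.

Lemma cV_sum_delta m (w : 'cV[R]_m) : w = \sum_a w a 0 *: delta_mx a 0.
Proof.
rewrite [LHS]matrix_sum_delta; apply: eq_bigr => a _.
by rewrite big_ord_recl big_ord0 addr0.
Qed.

Lemma dotv_grad m (f : 'cV[R]_m -> R) (x w : 'cV[R]_m) :
  differentiable (f : 'cV[R]_m -> R^o) x ->
  dotv (grad f x) w = 'd (f : 'cV[R]_m -> R^o) x w.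
Proof.
move=> df; rewrite [in RHS](cV_sum_delta w) linear_sum/= dotvE.
by apply: eq_bigr => a _; rewrite linearZ/= mxE deriveE// mulrC.
Qed.

Lemma tr_gradmx_mul m p (phi : 'cV[R]_m -> 'cV[R]_p) (x w : 'cV[R]_m) :
  differentiable phi x -> (gradmx phi x)^T *m w = 'd phi x w.
Proof.
move=> dphi; rewrite [in RHS](cV_sum_delta w) linear_sum/=.
apply/colP => b; rewrite mxE summxE; apply: eq_bigr => a _.
by rewrite linearZ/= !mxE deriveE// mulrC.
Qed.

Variables (N d : nat) (n : 'I_N -> nat).
Variable phi : forall i : 'I_N, 'cV[R]_(n i) -> 'cV[R]_d.
Variable g : forall i : 'I_N, 'cV[R]_(n i + d) -> R.
Arguments phi : clear implicits.
Arguments g : clear implicits.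
Hypothesis dg : forall i (z : 'cV[R]_(n i + d)),
  differentiable (g i : 'cV[R]_(n i + d) -> R^o) z.
Local Notation stackx := 'cV[R]_(\sum_(i < N) n i).

(* Block injections and projections are written as products by constant
   matrices, so that [diff_mulmx] differentiates all of them. *)
Let in1 i : 'M[R]_(n i + d, n i) := col_mx 1%:M 0.
Let in2 i : 'M[R]_(n i + d, d) := col_mx 0 1%:M.

Let in1E i (w : 'cV[R]_(n i)) : in1 i *m w = col_mx w 0.
Proof. by rewrite mul_col_mx mul1mx mul0mx. Qed.

Let in2E i (w : 'cV[R]_d) : in2 i *m w = col_mx 0 w.
Proof. by rewrite mul_col_mx mul1mx mul0mx. Qed.

(** Writing the partial gradient as the full differential on vectors with zero
    second block lets the chain rule work with differentials alone. *)
Lemma dotv_gradx i (x w : 'cV[R]_(n i)) (z : 'cV[R]_d) :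
  dotv (gradx g x z) w = 'd (g i : _ -> R^o) (col_mx x z) (col_mx w 0).
Proof.
have colE : (fun x' => col_mx x' z) = mulmx (in1 i) + cst (col_mx 0 z).
  by apply/funext => x'; rewrite !fctE in1E [RHS]add_col_mx addr0 add0r.
have dcol : differentiable (fun x' => col_mx x' z) x.
  by rewrite colE; apply: differentiableD => //; exact: differentiable_mulmx.
rewrite dotv_grad; last exact: (differentiable_comp dcol (dg _)).
rewrite (diff_comp dcol (dg _))/=; congr ('d _ _ _).
by rewrite colE diff_affine in1E.
Qed.

Lemma dotv_gradz i (x : 'cV[R]_(n i)) (z w : 'cV[R]_d) :
  dotv (gradz g x z) w = 'd (g i : _ -> R^o) (col_mx x z) (col_mx 0 w).
Proof.
have colE : (fun z' => col_mx x z') = mulmx (in2 i) + cst (col_mx x 0).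
  by apply/funext => z'; rewrite !fctE in2E [RHS]add_col_mx addr0 add0r.
have dcol : differentiable (fun z' => col_mx x z') z.
  by rewrite colE; apply: differentiableD => //; exact: differentiable_mulmx.
rewrite dotv_grad; last exact: (differentiable_comp dcol (dg _)).
rewrite (diff_comp dcol (dg _))/=; congr ('d _ _ _).
by rewrite colE diff_affine in2E.
Qed.

Let blk i : 'M[R]_(n i, \sum_(i < N) n i) := submxcol 1%:M i.

Let blkE i (x : stackx) : submxcol x i = blk i *m x.
Proof. by rewrite submxcol_mul mul1mx. Qed.

Section ChainRule.
Variable x : stackx.
Hypothesis dphi : forall i, differentiable (phi i) (submxcol x i).

Let dphi_blk i : differentiable (phi i \o mulmx (blk i)) x.
Proof.
apply: differentiable_comp; first exact: differentiable_mulmx.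
by rewrite -blkE.
Qed.

Let deltaE : delta phi = N%:R^-1 *: \sum_(i < N) (phi i \o mulmx (blk i)).
Proof.
apply/funext => u; rewrite /delta; congr (_ *: _).
by rewrite fct_sumE; apply: eq_bigr => i _; rewrite blkE.
Qed.

Lemma differentiable_delta : differentiable (delta phi) x.
Proof.
by rewrite deltaE; apply: differentiableZ; exact: differentiable_sum.
Qed.

Lemma diff_delta w : 'd (delta phi) x w =
  N%:R^-1 *: \sum_(i < N) (gradmx (phi i) (submxcol x i))^T *m submxcol w i.
Proof.
rewrite -deriveE; last exact: differentiable_delta.
rewrite deltaE deriveZ; last first.
  by apply: derivable_sum => i; exact: diff_derivable.
rewrite derive_sum; last by move=> i; exact: diff_derivable.
congr (_ *: _); apply: eq_bigr => i _; rewrite deriveE//.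
rewrite diff_comp; [|exact: differentiable_mulmx|by rewrite -blkE].
by rewrite /= diff_mulmx -!blkE tr_gradmx_mul.
Qed.

(** The i-th block of x enters the objective directly in the first argument of
    g_i and, through delta, in the second argument of every g_j; the latter
    effect is gathered into the mean of the gradients in z. *)
Lemma dotv_grad_objective w :
  dotv (grad (objective phi g) x) w =
  \sum_(i < N) dotv (gradx g (submxcol x i) (delta phi x)
    + gradmx (phi i) (submxcol x i) *m
      (N%:R^-1 *: \sum_(j < N) gradz g (submxcol x j) (delta phi x)))
    (submxcol w i).
Proof.
(* The argument of g_i as a function of the stacked vector. *)
pose inner i := (mulmx (in1 i) \o mulmx (blk i)) + (mulmx (in2 i) \o delta phi).
have innerE i u : inner i u = col_mx (submxcol u i) (delta phi u).
  rewrite /inner !fctE in1E in2E -blkE.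
  by rewrite [LHS]add_col_mx addr0 add0r.
have dblk i : differentiable (mulmx (in1 i) \o mulmx (blk i)) x.
  by apply: differentiable_comp; exact: differentiable_mulmx.
have ddelta i : differentiable (mulmx (in2 i) \o delta phi) x.
  apply: differentiable_comp; first exact: differentiable_delta.
  exact: differentiable_mulmx.
have dinner i : differentiable (inner i) x by exact: differentiableD.
have objE : objective phi g = \sum_(i < N) ((g i : _ -> R^o) \o inner i).
  apply/funext => u; rewrite fct_sumE; apply: eq_bigr => i _.
  by rewrite /= innerE.
have dgi i : differentiable ((g i : _ -> R^o) \o inner i) x.
  exact: differentiable_comp.
rewrite dotv_grad; last by rewrite objE; exact: differentiable_sum.
rewrite -deriveE; last by rewrite objE; exact: differentiable_sum.
rewrite objE derive_sum; last by move=> i; exact: diff_derivable.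
have -> : \sum_(i < N) 'D_w ((g i : _ -> R^o) \o inner i) x =
    \sum_(i < N) (dotv (gradx g (submxcol x i) (delta phi x)) (submxcol w i)
      + dotv (gradz g (submxcol x i) (delta phi x)) ('d (delta phi) x w)).
  apply: eq_bigr => i _; rewrite deriveE// diff_comp//= innerE.
  rewrite dotv_gradx dotv_gradz -linearD/=; congr ('d _ _ _).
  rewrite add_col_mx addr0 add0r diffD_app//.
  rewrite [X in X + _](_ : _ = col_mx (submxcol w i) 0); last first.
    rewrite diff_comp; [|exact: differentiable_mulmx..].
    by rewrite /= !diff_mulmx -blkE in1E.
  rewrite [X in _ + X](_ : _ = col_mx 0 ('d (delta phi) x w)).
    by rewrite [LHS]add_col_mx addr0 add0r.
  rewrite diff_comp; [|exact: differentiable_delta|exact: differentiable_mulmx].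
  by rewrite /= diff_mulmx in2E.
under [RHS]eq_bigr do rewrite dotvDl dotv_mulmxl.
rewrite !big_split/=; congr (_ + _).
rewrite -dotv_suml -dotv_sumr diff_delta dotvZr dotvZl; congr (_ * _).
Qed.

End ChainRule.
End Gradients.

(** * Uniform bounds on the local data *)

Lemma term_le_sum (R : numDomainType) (I : finType) (F : I -> R) i :
  (forall j, 0 <= F j) -> F i <= \sum_j F j.
Proof. by move=> F0; rewrite (bigD1 i)//= lerDl sumr_ge0. Qed.

Lemma compact_family_bounded (R : realType) (N : nat) (n : 'I_N -> nat)
    (X : forall i, set 'cV[R]_(n i)) :
  (forall i, compact (X i)) ->
  exists2 D, 0 <= D & forall i a, X i a -> `|a| <= D.
Proof.
move=> cX.
have XD : \forall D \near +oo%R, forall i, X i `<=` [set a | `|a| <= D].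
  apply: filter_forall => i; have [M [Mreal XM]] := compact_bounded (cX i).
  by exists M; split => // D /XM.
have [D [D0 DX]] := filter_ex (filterI (nbhs_pinfty_ge (num_real (0 : R))) XD).
by exists D.
Qed.

Section LocalBounds.
Variables (R : realType) (N d : nat) (n : 'I_N -> nat).
Variable X : forall i : 'I_N, set 'cV[R]_(n i).
Variable phi : forall i : 'I_N, 'cV[R]_(n i) -> 'cV[R]_d.
Variable g : forall i : 'I_N, 'cV[R]_(n i + d) -> R.
Hypothesis locals : local_function_assumption X phi g.
Arguments X : clear implicits.
Arguments phi : clear implicits.

Lemma norm_mxcolB (m : 'I_N -> nat) (a b : forall i, 'cV[R]_(m i)) :
  `|\mxcol_(i < N) a i - \mxcol_(i < N) b i| <= \sum_i `|a i - b i|.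
Proof.
apply: norm_le_blocks => [|i]; first exact: sumr_ge0.
by rewrite submxcolB !mxcolK (term_le_sum (F := fun i => `|a i - b i|)).
Qed.

Lemma gradx_lipschitz : exists2 C : R, 0 <= C &
  forall (a : forall i, 'cV[R]_(n i)) (z1 z2 : 'I_N -> 'cV[R]_d),
  (forall i, X i (a i)) ->
  forall i, `|gradx g (a i) (z1 i) - gradx g (a i) (z2 i)|
    <= C * \sum_j `|z1 j - z2 j|.
Proof.
have [l1 lip1] := grad1_lipschitz locals.
exists (`|l1| * (\sum_(i < N) d)%N%:R); first by rewrite mulr_ge0.
move=> a z1 z2 Xa i.
have fa : feasible X (\mxcol_i a i) by move=> j; rewrite mxcolK.
have lip := lipschitz_norm2_norm
  (lip1 (\mxcol_i a i) (\mxcol_i z1 i) (\mxcol_i z2 i) fa).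
apply: (@le_trans _ _ `|grad1 g (\mxcol_i a i) (\mxcol_i z1 i)
                      - grad1 g (\mxcol_i a i) (\mxcol_i z2 i)|).
  apply: le_trans (norm_submxcol _ i).
  by rewrite submxcolB !mxcolK.
apply: le_trans lip _; rewrite ler_wpM2l ?mulr_ge0//.
exact: (norm_mxcolB (m := fun=> d)).
Qed.

Lemma gradz_lipschitz : exists2 C : R, 0 <= C &
  forall (a1 a2 : forall i, 'cV[R]_(n i)) (z1 z2 : 'I_N -> 'cV[R]_d),
  (forall i, X i (a1 i)) -> (forall i, X i (a2 i)) ->
  forall i, `|gradz g (a1 i) (z1 i) - gradz g (a2 i) (z2 i)|
    <= C * (\sum_j `|a1 j - a2 j| + \sum_j `|z1 j - z2 j|).
Proof.
have [l2 lip2] := grad2_lipschitz locals.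
pose C1 := `|l2| * (\sum_(i < N) n i)%N%:R.
pose C2 := `|l2| * (\sum_(i < N) d)%N%:R.
have C10 : 0 <= C1 by rewrite mulr_ge0.
have C20 : 0 <= C2 by rewrite mulr_ge0.
exists (C1 + C2) => [|a1 a2 z1 z2 Xa1 Xa2 i]; first exact: addr_ge0.
have lip := lip2 (\mxcol_i a1 i) (\mxcol_i a2 i)
  (\mxcol_i z1 i) (\mxcol_i z2 i).
apply: (@le_trans _ _ `|grad2 g (\mxcol_i a1 i) (\mxcol_i z1 i)
                      - grad2 g (\mxcol_i a2 i) (\mxcol_i z2 i)|).
  apply: le_trans (norm_submxcol _ i).
  by rewrite submxcolB !mxcolK.
apply: le_trans (norm_le_norm2 _) _; apply: le_trans (lip _ _) _.
- by move=> j; rewrite mxcolK.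
- by move=> j; rewrite mxcolK.
have s10 : 0 <= \sum_j `|a1 j - a2 j| by exact: sumr_ge0.
have s20 : 0 <= \sum_j `|z1 j - z2 j| by exact: sumr_ge0.
rewrite mulrDr lerD//.
- apply: le_trans (scaled_norm2_le_norm _ _) _; rewrite ler_pM ?lerDl//.
  exact: norm_mxcolB.
- apply: le_trans (scaled_norm2_le_norm _ _) _; rewrite ler_pM ?lerDr//.
  exact: (norm_mxcolB (m := fun=> d)).
Qed.

Lemma phi_lipschitz_norm : exists2 C : R, 0 <= C &
  forall i a b, X i a -> X i b -> `|phi i a - phi i b| <= C * `|a - b|.
Proof.
have [l3 lip3] := phi_lipschitz locals.
pose C i := `|l3| * (n i)%:R.
have C0 i : 0 <= C i by rewrite mulr_ge0.
exists (\sum_i C i) => [|i a b Xa Xb]; first exact: sumr_ge0.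
apply: le_trans (lipschitz_norm2_norm (lip3 _ _ _ Xa Xb)) _.
by rewrite ler_wpM2r// term_le_sum.
Qed.

Lemma gradmx_mul_bound : exists2 C : R, 0 <= C &
  forall i a w, X i a -> `|gradmx (phi i) a *m (w : 'cV[R]_d)| <= C * `|w|.
Proof.
have [c [c0 cphi]] := phi_grad_bounded locals.
have c0' i : 0 <= c i by exact: ltW.
exists (d%:R * \sum_i c i) => [|i a w Xa]; first by rewrite mulr_ge0// sumr_ge0.
apply: le_trans (norm_mulmx _ _) _; rewrite ler_wpM2r// ler_wpM2l//.
apply: le_trans (norm_le_opnorm2 (c0' i) (cphi i a Xa)) _.
exact: term_le_sum.
Qed.

End LocalBounds.

(** * Convergence of the algorithm *)

Section Convergence.
Variables (R : realType) (N d : nat) (n : 'I_N -> nat).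
Variable X : forall i : 'I_N, set 'cV[R]_(n i).
Variable phi : forall i : 'I_N, 'cV[R]_(n i) -> 'cV[R]_d.
Variable g : forall i : 'I_N, 'cV[R]_(n i + d) -> R.
Arguments X : clear implicits.
Arguments phi : clear implicits.
Arguments g : clear implicits.
Variables (E : nat -> rel 'I_N) (W : nat -> 'M[R]_N) (gamma : nat -> R).
Variables x s : nat -> forall i : 'I_N, 'cV[R]_(n i).
Variables v y : nat -> 'I_N -> 'cV[R]_d.
Hypothesis dg : forall i (z : 'cV[R]_(n i + d)),
  differentiable (g i : 'cV[R]_(n i + d) -> R^o) z.
Hypothesis glob : constraint_objective_assumption X phi g.
Hypothesis locals : local_function_assumption X phi g.
Hypothesis net : network_assumption E W.
Hypothesis run : projection_free_run X phi g E W gamma x s v y.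
Hypothesis gamma01 : forall k, 0 <= gamma k <= 1.
Hypothesis gamma_cvg0 : gamma @ \oo --> 0.

Local Notation stack a := (\mxcol_(i < N) a i).
Local Notation mean w := (N%:R^-1 *: \sum_(j < N) w j).

Let avg k : 'cV[R]_d := mean (fun j => phi j (x k j)).

(** The cost vector of the linear problem that agent i solves. *)
Definition gradient_estimate k i : 'cV[R]_(n i) :=
  gradx g (x k i) (mix E W k (v k) i)
  + gradmx (phi i) (x k i) *m mix E W k (y k) i.

(** The i-th block of the gradient of the objective, see
    [dotv_grad_stack]. *)
Definition gradient_block k i : 'cV[R]_(n i) :=
  gradx g (x k i) (avg k)
  + gradmx (phi i) (x k i) *m mean (fun j => gradz g (x k j) (avg k)).

Lemma mixE k (u : 'I_N -> 'cV[R]_d) i : mix E W k u i = \sum_j W k i j *: u j.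
Proof.
rewrite /mix big_mkcond/=; apply: eq_bigr => j _; case: ifPn => // Eji.
by rewrite (weight_zero net Eji) scale0r.
Qed.

Lemma iterate_feasible k i : X i (x k i).
Proof.
elim: k i => [|k IHk] i; first exact: run_x0 run i.
have /andP[t0 t1] := gamma01 k.
have := @constraint_convex _ _ _ _ _ _ _ glob i (s k i) (x k i) (Itv01 t0 t1).
rewrite !inE => /(_ (proj1 (run_s run k i)) (IHk i)).
by rewrite (run_x run) addrC.
Qed.

Lemma stack_feasible k : feasible X (stack (x k)).
Proof. by move=> i; rewrite mxcolK; exact: iterate_feasible. Qed.

Lemma delta_stack k : delta phi (stack (x k)) = avg k.
Proof.
by rewrite /delta; congr (_ *: _); apply: eq_bigr => i _; rewrite mxcolK.
Qed.

Lemma dotv_grad_stack k w :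
  dotv (grad (objective phi g) (stack (x k))) w =
  \sum_i dotv (gradient_block k i) (submxcol w i).
Proof.
have dphi i : differentiable (phi i) (submxcol (stack (x k)) i).
  by rewrite mxcolK; exact/(phi_differentiable locals)/iterate_feasible.
rewrite (dotv_grad_objective dg dphi).
rewrite delta_stack.
have -> : \sum_(j < N) gradz g (submxcol (stack (x k)) j) (avg k) =
    \sum_(j < N) gradz g (x k j) (avg k).
  by apply: eq_bigr => j _; rewrite mxcolK.
by apply: eq_bigr => i _; rewrite mxcolK.
Qed.

Lemma iterate_step k i : x k.+1 i - x k i = gamma k *: (s k i - x k i).
Proof.
rewrite (run_x run) scalerBl scale1r scalerBr addrAC (addrAC (x k i)) subrr.
by rewrite add0r addrC.
Qed.

Lemma iterate_step_bound D k i :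
  (forall j a, X j a -> `|a| <= D) ->
  `|x k.+1 i - x k i| <= gamma k * (D + D).
Proof.
move=> XD; have /andP[g0 _] := gamma01 k.
rewrite iterate_step normrZ ger0_norm// ler_wpM2l//.
apply: le_trans (ler_normB _ _) _; rewrite lerD//; apply: (XD i).
  exact: (proj1 (run_s run k i)).
exact: iterate_feasible.
Qed.

Lemma iterate_step_cvg0 i : x k.+1 i - x k i @[k --> \oo] --> (0 : 'cV[R]_(n i)).
Proof.
have [D D0 XD] := compact_family_bounded (constraint_compact glob).
apply: (@cvg0_le _ _ _ (fun k => gamma k * (D + D))) => [k|].
  exact: iterate_step_bound.
by rewrite -(mul0r (D + D)); exact: cvgMl.
Qed.

Lemma phi_step_cvg0 i :
  phi i (x k.+1 i) - phi i (x k i) @[k --> \oo] --> (0 : 'cV[R]_d).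
Proof.
have [C C0 lip] := phi_lipschitz_norm locals.
apply: (@cvg0_le _ _ _ (fun k => C * `|x k.+1 i - x k i|)) => [k|].
  by apply: lip; exact: iterate_feasible.
apply: cvg0_scale; apply: (@cvg0_norm _ 'cV[R]_(n i)).
exact: iterate_step_cvg0.
Qed.

Let v_rec k i : v k.+1 i =
  \sum_j W k i j *: v k j + phi i (x k.+1 i) - phi i (x k i).
Proof. by rewrite (run_v run) mixE. Qed.

Lemma v_tracking i : v k i - avg k @[k --> \oo] --> (0 : 'cV[R]_d).
Proof.
exact: (tracking net (run_v0 run) v_rec phi_step_cvg0).
Qed.

Lemma mixed_v_tracking i : mix E W k (v k) i - avg k @[k --> \oo] --> (0 : 'cV[R]_d).
Proof.
under eq_cvg do rewrite mixE.
exact: (tracking_mixed net (run_v0 run) v_rec phi_step_cvg0).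
Qed.

Lemma v_step_cvg0 i : v k.+1 i - v k i @[k --> \oo] --> (0 : 'cV[R]_d).
Proof. exact: (tracking_step net (run_v0 run) v_rec phi_step_cvg0). Qed.

Let gz k i := gradz g (x k i) (v k i).

(** The increments of v vanish by consensus and not only because the steps are
    short: this is why v has to be treated before y. *)
Lemma gradz_step_cvg0 i : gz k.+1 i - gz k i @[k --> \oo] --> (0 : 'cV[R]_d).
Proof.
have [C C0 lip] := gradz_lipschitz locals.
apply: (@cvg0_le _ _ _ (fun k => C * (\sum_j `|x k.+1 j - x k j|
                                     + \sum_j `|v k.+1 j - v k j|))) => [k|].
  by apply: lip; exact: iterate_feasible.
apply: cvg0_scale; apply: cvg0D.
  apply: cvg_sum0 => j; apply: (@cvg0_norm _ 'cV[R]_(n j)).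
  exact: iterate_step_cvg0.
by apply: (@cvg0_sum_norm _ 'cV[R]_d) => j; exact: v_step_cvg0.
Qed.

Let y_rec k i : y k.+1 i = \sum_j W k i j *: y k j + gz k.+1 i - gz k i.
Proof. by rewrite (run_y run) mixE. Qed.

Lemma gradz_v_avg_cvg0 i :
  gz k i - gradz g (x k i) (avg k) @[k --> \oo] --> (0 : 'cV[R]_d).
Proof.
have [C C0 lip] := gradz_lipschitz locals.
apply: (@cvg0_le _ _ _ (fun k => C * \sum_j `|v k j - avg k|)) => [k|].
  have := lip (x k) (x k) (v k) (fun=> avg k) (iterate_feasible k)
    (iterate_feasible k) i.
  by under eq_bigr do rewrite subrr normr0; rewrite big1_eq add0r.
apply: cvg0_scale; apply: (@cvg0_sum_norm _ 'cV[R]_d) => j.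
exact: v_tracking.
Qed.

Lemma mixed_y_tracking i :
  mix E W k (y k) i - mean (fun j => gradz g (x k j) (avg k))
  @[k --> \oo] --> (0 : 'cV[R]_d).
Proof.
have H : (\sum_j W k i j *: y k j - mean (gz k))
    + mean (fun j => gz k j - gradz g (x k j) (avg k))
    @[k --> \oo] --> (0 + N%:R^-1 *: 0 : 'cV[R]_d).
  apply: cvgD.
    exact: (tracking_mixed net (run_y0 run) y_rec gradz_step_cvg0).
  by apply: cvgZr; apply: cvg_sum0 => j; exact: gradz_v_avg_cvg0.
rewrite scaler0 addr0 in H; apply: cvg_trans H; apply: near_eq_cvg.
by apply: nearW => k; rewrite mixE sumrB scalerBr subrKA.
Qed.

Lemma gradient_error_cvg0 i :
  gradient_block k i - gradient_estimate k i @[k --> \oo]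
    --> (0 : 'cV[R]_(n i)).
Proof.
have [C C0 lip] := gradx_lipschitz locals.
have [c c0 bnd] := gradmx_mul_bound locals.
pose w k := mix E W k (y k) i - mean (fun j => gradz g (x k j) (avg k)).
apply: (@cvg0_le _ _ _ (fun k => C * (\sum_j `|mix E W k (v k) j - avg k|)
                                 + c * `|w k|)) => [k|].
  rewrite distrC opprD addrACA -mulmxBr.
  apply: le_trans (ler_normD _ _) _; rewrite lerD//; last first.
    by apply: bnd; exact: iterate_feasible.
  exact: (lip (x k) (mix E W k (v k)) (fun=> avg k) (iterate_feasible k)).
apply: cvg0D; apply: cvg0_scale.
  by apply: (@cvg0_sum_norm _ 'cV[R]_d) => j; exact: mixed_v_tracking.
by apply: (@cvg0_norm _ 'cV[R]_d); exact: mixed_y_tracking.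
Qed.

Variable xstar : 'cV[R]_(\sum_(i < N) n i).
Hypothesis xstarP : is_argmin (feasible X) (objective phi g) xstar.

Let f := objective phi g.
Let gap k := f (stack (x k)) - f xstar.

Lemma gap_ge0 k : 0 <= gap k.
Proof. by rewrite subr_ge0; apply: (proj2 xstarP); exact: stack_feasible. Qed.

(** The one-step inequality of Frank-Wolfe with an inexact gradient. In e_k the
    sum is the loss from minimising along the estimate, and gamma_k M, with M
    made of the Lipschitz constant of the gradient and the squared diameter, is
    the loss from evaluating the gradient at the old iterate. *)
Lemma gap_descent : exists e : nat -> R, e @ \oo --> 0 /\
  forall k, gap k.+1 <= (1 - gamma k) * gap k + gamma k * e k.
Proof.
have [D D0 XD] := compact_family_bounded (constraint_compact glob).
have [L smooth] := objective_smooth glob.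
pose m := (\sum_(i < N) n i)%N.
pose M : R := m%:R * (D + D) * (`|L| * m%:R * (D + D)).
pose err k i := gradient_block k i - gradient_estimate k i.
exists (fun k => (\sum_i (n i)%:R * (D + D) * `|err k i|) + gamma k * M).
split.
  apply: cvg0D; last by rewrite -(mul0r M); exact: cvgMl.
  apply: cvg_sum0 => i; apply: cvg0_scale.
  by apply: (@cvg0_norm _ 'cV[R]_(n i)); exact: gradient_error_cvg0.
move=> k; have /andP[g0 g1] := gamma01 k.
pose x0 := stack (x k); pose x1 := stack (x k.+1); pose sk := stack (s k).
have step : x1 - x0 = gamma k *: (sk - x0).
  apply/mxcolP => i; rewrite submxcolB !mxcolK iterate_step.
  rewrite -[s k i](mxcolK (s k)) -[x k i](mxcolK (x k)) -submxcolB.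
  by apply/colP => a; rewrite !mxE.
have step_norm : `|x1 - x0| <= gamma k * (D + D).
  apply: norm_le_blocks => [|i]; first by rewrite mulr_ge0// addr_ge0.
  by rewrite submxcolB !mxcolK; exact: iterate_step_bound.
have curvature : dotv (grad f x1 - grad f x0) (x1 - x0)
    <= gamma k * (gamma k * M).
  apply: le_trans (ler_norm _) _; apply: le_trans (dotv_le_norm _ _) _.
  have lipf := lipschitz_norm2_norm
    (smooth _ _ (stack_feasible k.+1) (stack_feasible k)).
  have lip1 : `|grad f x1 - grad f x0| <= `|L| * m%:R * (gamma k * (D + D)).
    by apply: le_trans lipf _; rewrite ler_wpM2l// mulr_ge0.
  have -> : gamma k * (gamma k * M) =
      m%:R * (`|L| * m%:R * (gamma k * (D + D))) * (gamma k * (D + D)).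
    by rewrite /M; ring.
  by rewrite ler_pM ?mulr_ge0 ?ler_wpM2l.
have first_order a b : feasible X a -> feasible X b ->
    f a <= f b + dotv (grad f a) (a - b).
  move=> Fa Fb; have := objective_first_order glob Fa Fb.
  by rewrite dotvC !dotvBr -/f; lra.
have linear : dotv (grad f x0) (sk - x0) <=
    - gap k + \sum_i (n i)%:R * (D + D) * `|err k i|.
  have star := first_order _ _ (stack_feasible k) (proj1 xstarP).
  have est : dotv (grad f x0) (sk - xstar) <=
      \sum_i (n i)%:R * (D + D) * `|err k i|.
    rewrite dotv_grad_stack; apply: ler_sum => i _.
    rewrite submxcolB mxcolK.
    have -> : gradient_block k i = err k i + gradient_estimate k i.
      by rewrite subrK.
    rewrite dotvDl.
    have [Xs smin] := run_s run k i.
    have := smin _ (proj1 xstarP i).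
    rewrite -[X in dotv X _]/(gradient_estimate k i).
    rewrite -[X in _ <= dotv X _]/(gradient_estimate k i) => smin'.
    apply: (@le_trans _ _ (dotv (err k i) (s k i - submxcol xstar i))).
      by rewrite gerDl dotvBr subr_le0.
    apply: le_trans (ler_norm _) _; apply: le_trans (dotv_le_norm _ _) _.
    rewrite mulrAC ler_wpM2r// ler_wpM2l//.
    apply: le_trans (ler_normB _ _) _; rewrite lerD ?(XD i)//.
    exact: (proj1 xstarP i).
  have -> : sk - x0 = (sk - xstar) - (x0 - xstar) by rewrite opprB subrKA.
  rewrite (dotvBr (sk - xstar)) /gap -/x0.
  by move: star est; rewrite -/x0; lra.
have descent := first_order _ _ (stack_feasible k.+1) (stack_feasible k).
(* Convexity at x1, split as the linear term at x0 plus the curvature term. *)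
have step_dot : dotv (grad f x0) (x1 - x0) =
    gamma k * dotv (grad f x0) (sk - x0) by rewrite step dotvZr.
have gapS : gap k.+1 = f x1 - f x0 + gap k by rewrite /gap addrA subrK.
rewrite dotvBl step_dot in curvature; rewrite gapS.
move: curvature descent (ler_wpM2l g0 linear); rewrite -/x0 -/x1.
move: (\sum_i (n i)%:R * (D + D) * `|err k i|).
move: (dotv _ (sk - x0)) (dotv _ (x1 - x0)) (f x1) (f x0) (gap k).
by move=> lin0 lin1 f1 f0 gapk loss; nra.
Qed.

Lemma objective_cvg :
  (forall M, exists m, M <= \sum_(k < m) gamma k) ->
  f (stack (x k)) @[k --> \oo] --> f xstar.
Proof.
move=> gdiv; have [e [e0 rec]] := gap_descent.
apply/subr_cvg0; exact: cvg0_averaging gap_ge0 gamma01 gdiv e0 rec.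
Qed.

End Convergence.

Theorem theorem1 (R : realType) (N d : nat) (n : 'I_N -> nat)
  (X : forall i : 'I_N, set 'cV[R]_(n i))
  (phi : forall i : 'I_N, 'cV[R]_(n i) -> 'cV[R]_d)
  (g : forall i : 'I_N, 'cV[R]_(n i + d) -> R)
  (E : nat -> rel 'I_N) (W : nat -> 'M[R]_N)
  (gamma : nat -> R)
  (x s : nat -> forall i : 'I_N, 'cV[R]_(n i))
  (v y : nat -> 'I_N -> 'cV[R]_d)
  (xstar : 'cV[R]_(\sum_(i < N) n i)) :
  (0 < N)%N ->
  (forall i, X i !=set0) ->
  (forall i (z : 'cV[R]_(n i + d)), differentiable (g i : 'cV[R]_(n i + d) -> R^o) z) ->
  constraint_objective_assumption X phi g ->
  local_function_assumption X phi g ->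
  network_assumption E W ->
  is_argmin (feasible X) (objective phi g) xstar ->
  projection_free_run X phi g E W gamma x s v y ->
  (forall k, 0 <= gamma k < 1) ->
  (forall k, 0 <= gamma k.+1 <= gamma k /\ gamma k <= 1) ->
  (\sum_(0 <= k <oo) (gamma k)%:E = +oo)%E ->
  (\sum_(0 <= k <oo) ((gamma k) ^+ 2)%:E < +oo)%E ->
  objective phi g (\mxcol_(i < N) x k i) @[k --> \oo]
    --> objective phi g xstar.
Proof.
move=> N0 X0 dg glob locals net xstarP run.
move=> gamma01 gamma_decr gamma_sum gamma2_sum.
have gamma_ge0 k : 0 <= gamma k by have /andP[] := gamma01 k.
apply: (objective_cvg dg glob locals net run _ _ xstarP).
- by move=> k; rewrite gamma_ge0; have [] := gamma_decr k.
- apply: nonincreasing_square_summable_cvg0 => // k.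
  by have [/andP[]] := gamma_decr k.
- exact: nneseries_pinfty_unbounded.
Qed.
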